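(* Let $\mathbb{K}$ be a commutative ring with identity, and let $\eta\colon\mathfrak{m}\to\mathfrak{g}$ and $\mu\colon\mathfrak{n}\to\mathfrak{g}$ be two crossed modules of Leibniz algebras over $\mathbb{K}$, with $\mathfrak{m}$ and $\mathfrak{n}$ acting on each other via the actions of $\mathfrak{g}$. Then there is an exact sequence of Leibniz algebras $$\Gamma\Big(\frac{\mathfrak{m}\times_{\mathfrak{g}}\mathfrak{n}}{\langle\mathfrak{m},\mathfrak{n}\rangle}\oplus\frac{\mathfrak{m}\times_{\mathfrak{g}}\mathfrak{n}}{\langle\mathfrak{m},\mathfrak{n}\rangle}\Big)\overset{\widetilde\psi}{\longrightarrow}\mathfrak{m}\star\mathfrak{n}\overset{\pi}{\longrightarrow}\mathfrak{m}\curlywedge\mathfrak{n}\to0,$$ where $\pi$ is the canonical projection and $\widetilde\psi\big(\gamma((m,n)+\langle\mathfrak{m},\mathfrak{n}\rangle,\,(m',n')+\langle\mathfrak{m},\mathfrak{n}\rangle)\big)=m*n'-n*m'$ for $(m,n),(m',n')\in\mathfrak{m}\times_{\mathfrak{g}}\mathfrak{n}$ (in particular, $\widetilde\psi$ is well defined).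
   Context: $\mathbb{K}$ is a commutative ring with identity. A Leibniz algebra is a $\mathbb{K}$-module with a $\mathbb{K}$-bilinear bracket satisfying $[x,[y,z]]=[[x,y],z]-[[x,z],y]$. It is abelian if its bracket is zero. A Leibniz action of $\mathfrak{m}$ on $\mathfrak{n}$ is a pair of bilinear maps $(m,n)\mapsto{}^mn$, $(n,m)\mapsto n^m$ into $\mathfrak{n}$ with ${}^{[m,m']}n={}^m({}^{m'}n)+({}^mn)^{m'}$, ${}^m[n,n']=[{}^mn,n']-[{}^mn',n]$, $n^{[m,m']}=(n^m)^{m'}-(n^{m'})^m$, $[n,n']^m=[n^m,n']+[n,n'^m]$, ${}^m({}^{m'}n)=-{}^m(n^{m'})$, $[n,{}^mn']=-[n,n'^m]$. A Leibniz crossed module is a homomorphism $\eta\colon\mathfrak{m}\to\mathfrak{g}$ with an action of $\mathfrak{g}$ on $\mathfrak{m}$ such that $\eta({}^xm)=[x,\eta(m)]$, $\eta(m^x)=[\eta(m),x]$, ${}^{\eta(m_1)}m_2=[m_1,m_2]=m_1^{\eta(m_2)}$. Given crossed modules $\eta\colon\mathfrak{m}\to\mathfrak{g}$, $\mu\colon\mathfrak{n}\to\mathfrak{g}$, the mutual actions are ${}^mn={}^{\eta(m)}n$, $n^m=n^{\eta(m)}$, ${}^nm={}^{\mu(n)}m$, $m^n=m^{\mu(n)}$. $\mathfrak{m}\star\mathfrak{n}$ is the Leibniz algebra generated by symbols $m*n$ and $n*m$ ($m\in\mathfrak{m}$, $n\in\mathfrak{n}$; two formally distinct families), both $\mathbb{K}$-bilinear,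 subject to: $m*[n,n']=m^n*n'-m^{n'}*n$; $n*[m,m']=n^m*m'-n^{m'}*m$; $[m,m']*n={}^mn*m'-m*n^{m'}$; $[n,n']*m={}^nm*n'-n*m^{n'}$; $m*{}^{m'}n=-m*n^{m'}$; $n*{}^{n'}m=-n*m^{n'}$; $m^n*{}^{m'}n'=[m*n,m'*n']={}^mn*m'^{n'}$; ${}^nm*n'^{m'}=[n*m,n'*m']=n^m*{}^{n'}m'$; $m^n*n'^{m'}=[m*n,n'*m']={}^mn*{}^{n'}m'$; ${}^nm*{}^{m'}n'=[n*m,m'*n']=n^m*m'^{n'}$. There are homomorphisms $\tau_{\mathfrak{m}}\colon\mathfrak{m}\star\mathfrak{n}\to\mathfrak{m}$, $m*n\mapsto m^n$, $n*m\mapsto{}^nm$, and $\tau_{\mathfrak{n}}\colon\mathfrak{m}\star\mathfrak{n}\to\mathfrak{n}$, $m*n\mapsto{}^mn$, $n*m\mapsto n^m$. $\mathfrak{m}\square\mathfrak{n}$ is the submodule of $\mathfrak{m}\star\mathfrak{n}$ generated by all $m*n'-n*m'$ with $\eta(m)=\mu(n)$ and $\eta(m')=\mu(n')$; it is a central ideal, and $\mathfrak{m}\curlywedge\mathfrak{n}=(\mathfrak{m}\star\mathfrak{n})/(\mathfrak{m}\square\mathfrak{n})$. $\mathfrak{m}\times_{\mathfrak{g}}\mathfrak{n}=\{(m,n)\in\mathfrak{m}\oplus\mathfrak{n}\mid\eta(m)=\mu(n)\}$, and $\langle\mathfrak{m},\mathfrak{n}\rangle=\{(\tau_{\mathfrak{m}}(x),\tau_{\mathfrak{n}}(x))\mid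 x\in\mathfrak{m}\star\mathfrak{n}\}$, which is an ideal of $\mathfrak{m}\times_{\mathfrak{g}}\mathfrak{n}$ with abelian quotient. Universal quadratic functor: for a $\mathbb{K}$-module $A$, $\Gamma(A)$ is the $\mathbb{K}$-module generated by symbols $\gamma(a)$, $a\in A$, subject to $k^2\gamma(a)=\gamma(ka)$; $\gamma(a+b+c)+\gamma(a)+\gamma(b)+\gamma(c)=\gamma(a+b)+\gamma(a+c)+\gamma(b+c)$; $\gamma(ka+b)+k\gamma(a)+k\gamma(b)=k\gamma(a+b)+\gamma(ka)+\gamma(b)$ for $k\in\mathbb{K}$, $a,b,c\in A$. $\Gamma(A)$ is regarded as an abelian Leibniz algebra. *)

(* Defs.v *)
From HB Require Import structures.
From mathcomp Require Import all_boot all_order all_algebra.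
From mathcomp Require Import generic_quotient ring_quotient.
From mathcomp Require Import boolp classical_sets.

Set Implicit Arguments.
Unset Strict Implicit.
Unset Printing Implicit Defensive.

Import GRing.Theory.
Local Open Scope classical_set_scope.
Local Open Scope ring_scope.
Local Open Scope quotient_scope.

Reserved Notation "⟦ x , y ⟧" (at level 0, x, y at level 99, format "⟦ x ,  y ⟧").

Section ModuleQuotient.
Variables (K : pzRingType) (V : lmodType K) (S : submodClosed V).

(* Over a ring a submodClosed predicate is stable under opposite, which
   [Quotient.quot] requires and the hierarchy does not infer. *)
Definition submod_pred : {pred V} := fun x => x \in S.

HB.instance Definition _ := GRing.isZmodClosed.Build V submod_pred
  (GRing.submod_closedB (submodClosedP S)).

Definition modq : Type := Quotient.quot submod_pred.

HB.instance Definition _ := Choice.on modq.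
HB.instance Definition _ := GRing.Zmodule.on modq.

Definition modq_pi (x : V) : modq := \pi_(Quotient.quot submod_pred) x.

Lemma modq_piP (x y : V) : modq_pi x = modq_pi y <-> x - y \in S.
Proof.
rewrite -[x - y \in S]/(x - y \in submod_pred) Quotient.idealrBE.
by split => [/eqP|/eqP].
Qed.

Definition modq_repr (x : modq) : V := repr x.

Lemma modq_reprK : cancel modq_repr modq_pi.
Proof. exact: reprK. Qed.

Definition modq_scale (a : K) (x : modq) : modq := modq_pi (a *: modq_repr x).

Lemma modq_piD x y : modq_pi (x + y) = modq_pi x + modq_pi y.
Proof. exact: (raddfD (\pi_(Quotient.quot submod_pred))). Qed.

Lemma modq_piZ a x : modq_pi (a *: x) = modq_scale a (modq_pi x).
Proof.
apply/modq_piP; rewrite -scalerBr; apply: rpredZ.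
by apply/modq_piP; rewrite modq_reprK.
Qed.

Lemma modq_scalerA a b (v : modq) :
  modq_scale a (modq_scale b v) = modq_scale (a * b) v.
Proof. by rewrite -[v]modq_reprK -!modq_piZ scalerA. Qed.

Lemma modq_scale1r : left_id 1 modq_scale.
Proof. by move=> v; rewrite -[v]modq_reprK -!modq_piZ scale1r. Qed.

Lemma modq_scalerDr : right_distributive modq_scale +%R.
Proof.
move=> a u v; rewrite -[u]modq_reprK -[v]modq_reprK.
by rewrite -modq_piD -!modq_piZ scalerDr modq_piD.
Qed.

Lemma modq_scalerDl v : {morph modq_scale^~ v : a b / a + b}.
Proof.
by move=> a b /=; rewrite -[v]modq_reprK -!modq_piZ scalerDl modq_piD.
Qed.

HB.instance Definition _ := GRing.Zmodule_isLmodule.Build K modq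
  modq_scalerA modq_scale1r modq_scalerDr modq_scalerDl.

Lemma modq_pi_linear : linear modq_pi.
Proof. by move=> a u v; rewrite modq_piD modq_piZ. Qed.

HB.instance Definition _ := GRing.isLinear.Build K V modq _ modq_pi
  modq_pi_linear.

End ModuleQuotient.

Section Span.
Variables (K : pzRingType) (V : lmodType K) (G : set V).

Definition span : {pred V} :=
  fun x => `[< smallest (fun M : set V => GRing.submod_closed [in M]) G x >].

Lemma spanP x :
  reflect (forall M : set V, GRing.submod_closed [in M] -> G `<=` M -> M x)
          (x \in span).
Proof.
apply: (iffP (asboolP _)) => [sx M CM GM|sx M [CM GM]]; last exact: sx.
by apply: sx.
Qed.

Lemma span_submod_closed : GRing.submod_closed span.
Proof.
split; first by apply/spanP => M [M0 _] _; exact: set_mem.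
move=> a u v /spanP su /spanP sv; apply/spanP => M CM GM.
by apply: set_mem; apply: (proj2 CM); apply: mem_set; [apply: su | apply: sv].
Qed.

HB.instance Definition _ := GRing.isSubmodClosed.Build K V span
  (GRing.submod_closed_semi span_submod_closed).

End Span.

HB.mixin Record Lmodule_isLeibniz (K : comPzRingType) L
    of GRing.Lmodule K L := {
  leib_br : L -> L -> L;
  leib_br_linearl : forall y, linear (fun x => leib_br x y);
  leib_br_linearr : forall x, linear (leib_br x);
  leib_brA : forall x y z,
    leib_br x (leib_br y z) = leib_br (leib_br x y) z - leib_br (leib_br x z) y
}.

#[short(type="leibnizType")]
HB.structure Definition Leibniz (K : comPzRingType) :=
  {L of GRing.Lmodule K L & Lmodule_isLeibniz K L}.

Notation "⟦ x , y ⟧" := (leib_br x y) : ring_scope.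

HB.mixin Record isLeibnizMorphism (K : comPzRingType) (L M : leibnizType K)
    (f : L -> M) := {
  leib_morph : {morph f : x y / ⟦ x, y ⟧}
}.

HB.structure Definition LeibnizMorphism (K : comPzRingType)
    (L M : leibnizType K) :=
  {f of @GRing.Linear K L M *:%R f & isLeibnizMorphism K L M f}.

Notation "{ 'leibniz' L -> M }" := (LeibnizMorphism.type L M)
  (at level 0, L at level 98, M at level 99, format "{ 'leibniz'  L  ->  M }")
  : type_scope.

Section LeibnizTheory.
Variables (K : comPzRingType) (L : leibnizType K).
Implicit Types x y z : L.

Lemma leib_brDl x y z : ⟦ x + y, z ⟧ = ⟦ x, z ⟧ + ⟦ y, z ⟧.
Proof. by have /= := leib_br_linearl z 1 x y; rewrite !scale1r. Qed.

Lemma leib_brDr x y z : ⟦ x, y + z ⟧ = ⟦ x, y ⟧ + ⟦ x, z ⟧.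
Proof. by have /= := leib_br_linearr x 1 y z; rewrite !scale1r. Qed.

Lemma leib_br0l z : ⟦ 0, z ⟧ = 0.
Proof. by apply: (addIr ⟦ 0, z ⟧); rewrite -leib_brDl !add0r. Qed.

Lemma leib_br0r z : ⟦ z, 0 ⟧ = 0.
Proof. by apply: (addIr ⟦ z, 0 ⟧); rewrite -leib_brDr !add0r. Qed.

Lemma leib_brZl a x z : ⟦ a *: x, z ⟧ = a *: ⟦ x, z ⟧.
Proof. by have /= := leib_br_linearl z a x 0; rewrite leib_br0l !addr0. Qed.

Lemma leib_brZr a x z : ⟦ z, a *: x ⟧ = a *: ⟦ z, x ⟧.
Proof. by have /= := leib_br_linearr z a x 0; rewrite leib_br0r !addr0. Qed.

Lemma leib_brNl x z : ⟦ - x, z ⟧ = - ⟦ x, z ⟧.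
Proof. by rewrite -scaleN1r leib_brZl scaleN1r. Qed.

Lemma leib_brNr x z : ⟦ z, - x ⟧ = - ⟦ z, x ⟧.
Proof. by rewrite -scaleN1r leib_brZr scaleN1r. Qed.

End LeibnizTheory.

Definition leib_ideal_closed (K : comPzRingType) (L : leibnizType K)
    (I : {pred L}) : Prop :=
  forall x y, x \in I -> ⟦ x, y ⟧ \in I /\ ⟦ y, x ⟧ \in I.

HB.mixin Record isLeibnizIdeal (K : comPzRingType) (L : leibnizType K)
    (I : {pred L}) := {
  leib_idealP : leib_ideal_closed I
}.

#[short(type="leibnizIdeal")]
HB.structure Definition LeibnizIdeal (K : comPzRingType) (L : leibnizType K) :=
  {I of @GRing.SubmodClosed K L I & isLeibnizIdeal K L I}.

Section LeibnizQuotient.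
Variables (K : comPzRingType) (L : leibnizType K) (I : leibnizIdeal L).

Definition leibq : Type := modq I.
HB.instance Definition _ := GRing.Lmodule.on leibq.

Definition leibq_pi : L -> leibq := @modq_pi K L I.
HB.instance Definition _ := GRing.Linear.on leibq_pi.

Definition leibq_repr : leibq -> L := @modq_repr K L I.

Lemma leibq_reprK : cancel leibq_repr leibq_pi.
Proof. exact: modq_reprK. Qed.

Lemma leibq_piP (x y : L) : leibq_pi x = leibq_pi y <-> x - y \in I.
Proof. exact: modq_piP. Qed.

Definition leibq_br (x y : leibq) : leibq :=
  leibq_pi ⟦ leibq_repr x, leibq_repr y ⟧.

Lemma leibq_pi_br x y : leibq_pi ⟦ x, y ⟧ = leibq_br (leibq_pi x) (leibq_pi y).
Proof.
apply/leibq_piP; set x' := leibq_repr _; set y' := leibq_repr _.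
have Ix : x - x' \in I by apply/leibq_piP; rewrite leibq_reprK.
have Iy : y - y' \in I by apply/leibq_piP; rewrite leibq_reprK.
have -> : ⟦ x, y ⟧ - ⟦ x', y' ⟧ = ⟦ x - x', y ⟧ + ⟦ x', y - y' ⟧.
  by rewrite leib_brDl leib_brDr leib_brNl leib_brNr addrA addrNK.
by apply: rpredD; [case: (leib_idealP _ y Ix) | case: (leib_idealP _ x' Iy)].
Qed.

Lemma leibq_br_linearl y : linear (fun x => leibq_br x y).
Proof.
move=> a u v; rewrite -[u]leibq_reprK -[v]leibq_reprK -[y]leibq_reprK.
by rewrite -linearP -!leibq_pi_br leib_brDl leib_brZl linearP.
Qed.

Lemma leibq_br_linearr x : linear (leibq_br x).
Proof.
move=> a u v; rewrite -[u]leibq_reprK -[v]leibq_reprK -[x]leibq_reprK.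
by rewrite -linearP -!leibq_pi_br leib_brDr leib_brZr linearP.
Qed.

Lemma leibq_brA x y z :
  leibq_br x (leibq_br y z) =
  leibq_br (leibq_br x y) z - leibq_br (leibq_br x z) y.
Proof.
rewrite -[x]leibq_reprK -[y]leibq_reprK -[z]leibq_reprK.
by rewrite -!leibq_pi_br leib_brA linearB.
Qed.

HB.instance Definition _ := Lmodule_isLeibniz.Build K leibq
  leibq_br_linearl leibq_br_linearr leibq_brA.

Lemma leibq_pi_morph : {morph leibq_pi : x y / ⟦ x, y ⟧}.
Proof. exact: leibq_pi_br. Qed.

HB.instance Definition _ := isLeibnizMorphism.Build K L leibq leibq_pi
  leibq_pi_morph.

End LeibnizQuotient.

Section IdealGenerated.
Variables (K : comPzRingType) (L : leibnizType K) (G : set L).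

Definition ideal_gen : {pred L} := fun x =>
  `[< smallest (fun I : set L =>
        GRing.submod_closed [in I] /\ leib_ideal_closed [in I]) G x >].

Lemma ideal_genP x :
  reflect (forall I : set L, GRing.submod_closed [in I] ->
             leib_ideal_closed [in I] -> G `<=` I -> I x)
          (x \in ideal_gen).
Proof.
apply: (iffP (asboolP _)) => [sx I CI II GI|sx I [[CI II] GI]]; last exact: sx.
by apply: sx.
Qed.

Lemma ideal_gen_submod_closed : GRing.submod_closed ideal_gen.
Proof.
split; first by apply/ideal_genP => I [I0 _] _ _; exact: set_mem.
move=> a u v /ideal_genP su /ideal_genP sv; apply/ideal_genP => I CI II GI.
by apply: set_mem; apply: (proj2 CI); apply: mem_set; [apply: su | apply: sv].
Qed.

HB.instance Definition _ := GRing.isSubmodClosed.Build K L ideal_gen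
  (GRing.submod_closed_semi ideal_gen_submod_closed).

Lemma ideal_gen_ideal_closed : leib_ideal_closed ideal_gen.
Proof.
move=> x y /ideal_genP sx.
by split; apply/ideal_genP => I CI II GI; apply: set_mem;
  case: (II x y) => //; apply: mem_set; exact: sx.
Qed.

HB.instance Definition _ := isLeibnizIdeal.Build K L ideal_gen
  ideal_gen_ideal_closed.

Lemma ideal_gen_sub x : G x -> x \in ideal_gen.
Proof. by move=> Gx; apply/ideal_genP => I _ _; apply. Qed.

End IdealGenerated.

(* The free K-module on a type, as formal expressions modulo the congruence
   generated by the module axioms. *)
Section FreeModule.
Variables (K : comPzRingType) (X : Type).

Inductive mterm : Type :=
| MGen of X
| MZero
| MAdd of mterm & mterm
| MScale of K & mterm.

Inductive mterm_eq : mterm -> mterm -> Prop :=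
| mterm_eq_refl t : mterm_eq t t
| mterm_eq_sym t u : mterm_eq t u -> mterm_eq u t
| mterm_eq_trans t u v : mterm_eq t u -> mterm_eq u v -> mterm_eq t v
| mterm_eq_add t t' u u' : mterm_eq t t' -> mterm_eq u u' ->
    mterm_eq (MAdd t u) (MAdd t' u')
| mterm_eq_scale a t t' : mterm_eq t t' -> mterm_eq (MScale a t) (MScale a t')
| mterm_eq_addA t u v : mterm_eq (MAdd t (MAdd u v)) (MAdd (MAdd t u) v)
| mterm_eq_addC t u : mterm_eq (MAdd t u) (MAdd u t)
| mterm_eq_add0 t : mterm_eq (MAdd MZero t) t
| mterm_eq_addN t : mterm_eq (MAdd (MScale (-1) t) t) MZero
| mterm_eq_scaleA a b t :
    mterm_eq (MScale a (MScale b t)) (MScale (a * b) t)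
| mterm_eq_scale1 t : mterm_eq (MScale 1 t) t
| mterm_eq_scaleDr a t u :
    mterm_eq (MScale a (MAdd t u)) (MAdd (MScale a t) (MScale a u))
| mterm_eq_scaleDl a b t :
    mterm_eq (MScale (a + b) t) (MAdd (MScale a t) (MScale b t)).

HB.instance Definition _ := gen_eqMixin mterm.
HB.instance Definition _ := gen_choiceMixin mterm.

Definition mterm_eqb : rel mterm := fun t u => `[< mterm_eq t u >].

Lemma mterm_eqb_equiv : equiv_class_of mterm_eqb.
Proof.
split=> [t|t u|u t v].
- exact/asboolP/mterm_eq_refl.
- by apply/asboolP/asboolP; apply: mterm_eq_sym.
- by move=> /asboolP tu /asboolP uv; apply/asboolP; exact: mterm_eq_trans uv.
Qed.

Canonical mterm_equiv := EquivRelPack mterm_eqb_equiv.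
Canonical mterm_encModRel := defaultEncModRel mterm_eqb.

Definition free_mod : Type := {eq_quot mterm_eqb}.
HB.instance Definition _ := Choice.on free_mod.

Definition free_mod_pi (t : mterm) : free_mod := \pi_({eq_quot mterm_eqb}) t.
Definition free_mod_repr (x : free_mod) : mterm := repr x.

Lemma free_mod_reprK : cancel free_mod_repr free_mod_pi.
Proof. exact: reprK. Qed.

Lemma free_mod_piP t u : free_mod_pi t = free_mod_pi u <-> mterm_eq t u.
Proof.
by split=> [/eqmodP/asboolP|tu] //; apply/eqmodP/asboolP.
Qed.

Definition free_mod_add (x y : free_mod) : free_mod :=
  free_mod_pi (MAdd (free_mod_repr x) (free_mod_repr y)).
Definition free_mod_scale (a : K) (x : free_mod) : free_mod :=
  free_mod_pi (MScale a (free_mod_repr x)).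

Lemma free_mod_piD t u :
  free_mod_pi (MAdd t u) = free_mod_add (free_mod_pi t) (free_mod_pi u).
Proof.
by apply/free_mod_piP; apply: mterm_eq_add; apply/free_mod_piP;
  rewrite free_mod_reprK.
Qed.

Lemma free_mod_piZ a t :
  free_mod_pi (MScale a t) = free_mod_scale a (free_mod_pi t).
Proof.
by apply/free_mod_piP; apply: mterm_eq_scale; apply/free_mod_piP;
  rewrite free_mod_reprK.
Qed.

Fact free_mod_addA : associative free_mod_add.
Proof.
move=> x y z; rewrite -[x]free_mod_reprK -[y]free_mod_reprK -[z]free_mod_reprK.
by rewrite -!free_mod_piD; apply/free_mod_piP; constructor.
Qed.

Fact free_mod_addC : commutative free_mod_add.
Proof.
move=> x y; rewrite -[x]free_mod_reprK -[y]free_mod_reprK -!free_mod_piD.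
by apply/free_mod_piP; apply: mterm_eq_addC.
Qed.

Fact free_mod_add0 : left_id (free_mod_pi MZero) free_mod_add.
Proof.
move=> x; rewrite -[x]free_mod_reprK -!free_mod_piD.
by apply/free_mod_piP; apply: mterm_eq_add0.
Qed.

Fact free_mod_addN :
  left_inverse (free_mod_pi MZero) (free_mod_scale (-1)) free_mod_add.
Proof.
move=> x; rewrite -[x]free_mod_reprK -free_mod_piZ -!free_mod_piD.
by apply/free_mod_piP; apply: mterm_eq_addN.
Qed.

HB.instance Definition _ := GRing.isZmodule.Build free_mod
  free_mod_addA free_mod_addC free_mod_add0 free_mod_addN.

Fact free_mod_scaleA a b (v : free_mod) :
  free_mod_scale a (free_mod_scale b v) = free_mod_scale (a * b) v.
Proof.
rewrite -[v]free_mod_reprK -!free_mod_piZ.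
by apply/free_mod_piP; apply: mterm_eq_scaleA.
Qed.

Fact free_mod_scale1 : left_id 1 free_mod_scale.
Proof.
move=> v; rewrite -[v]free_mod_reprK -!free_mod_piZ.
by apply/free_mod_piP; apply: mterm_eq_scale1.
Qed.

Fact free_mod_scaleDr : right_distributive free_mod_scale +%R.
Proof.
move=> a u v; rewrite -[u]free_mod_reprK -[v]free_mod_reprK.
rewrite -[_ + _]free_mod_piD -!free_mod_piZ -[RHS]free_mod_piD.
by apply/free_mod_piP; apply: mterm_eq_scaleDr.
Qed.

Fact free_mod_scaleDl v : {morph free_mod_scale^~ v : a b / a + b}.
Proof.
move=> a b /=; rewrite -[v]free_mod_reprK -!free_mod_piZ -[RHS]free_mod_piD.
by apply/free_mod_piP; apply: mterm_eq_scaleDl.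
Qed.

HB.instance Definition _ := GRing.Zmodule_isLmodule.Build K free_mod
  free_mod_scaleA free_mod_scale1 free_mod_scaleDr free_mod_scaleDl.

Definition free_mod_gen (x : X) : free_mod := free_mod_pi (MGen x).

Section Lift.
Variables (V : lmodType K) (f : X -> V).

Fixpoint mterm_eval (t : mterm) : V :=
  match t with
  | MGen x => f x
  | MZero => 0
  | MAdd t u => mterm_eval t + mterm_eval u
  | MScale a t => a *: mterm_eval t
  end.

Lemma mterm_eval_eq t u : mterm_eq t u -> mterm_eval t = mterm_eval u.
Proof.
elim=> //=; do ?by [move=> *; congruence].
- by move=> *; rewrite addrA.
- by move=> *; rewrite addrC.
- by move=> *; rewrite add0r.
- by move=> *; rewrite scaleN1r addNr.
- by move=> *; rewrite scalerA.
- by move=> *; rewrite scale1r.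
- by move=> *; rewrite scalerDr.
- by move=> *; rewrite scalerDl.
Qed.

Definition free_mod_lift (x : free_mod) : V := mterm_eval (free_mod_repr x).

Lemma free_mod_lift_pi t : free_mod_lift (free_mod_pi t) = mterm_eval t.
Proof. by apply: mterm_eval_eq; apply/free_mod_piP; rewrite free_mod_reprK. Qed.

Lemma free_mod_lift_linear : linear free_mod_lift.
Proof.
move=> a u v; rewrite -[u]free_mod_reprK -[v]free_mod_reprK.
by rewrite -[a *: _]free_mod_piZ -[_ + _ in LHS]free_mod_piD !free_mod_lift_pi.
Qed.

HB.instance Definition _ := GRing.isLinear.Build K free_mod V _ free_mod_lift
  free_mod_lift_linear.

Lemma free_mod_lift_gen x : free_mod_lift (free_mod_gen x) = f x.
Proof. exact: free_mod_lift_pi. Qed.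

End Lift.

End FreeModule.

(* The free Leibniz algebra on a type, likewise with the Leibniz axioms. *)
Section FreeLeibniz.
Variables (K : comPzRingType) (X : Type).

Inductive lterm : Type :=
| LGen of X
| LZero
| LAdd of lterm & lterm
| LScale of K & lterm
| LBr of lterm & lterm.

Inductive lterm_eq : lterm -> lterm -> Prop :=
| lterm_eq_refl t : lterm_eq t t
| lterm_eq_sym t u : lterm_eq t u -> lterm_eq u t
| lterm_eq_trans t u v : lterm_eq t u -> lterm_eq u v -> lterm_eq t v
| lterm_eq_add t t' u u' : lterm_eq t t' -> lterm_eq u u' ->
    lterm_eq (LAdd t u) (LAdd t' u')
| lterm_eq_scale a t t' : lterm_eq t t' -> lterm_eq (LScale a t) (LScale a t')
| lterm_eq_br t t' u u' : lterm_eq t t' -> lterm_eq u u' ->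
    lterm_eq (LBr t u) (LBr t' u')
| lterm_eq_addA t u v : lterm_eq (LAdd t (LAdd u v)) (LAdd (LAdd t u) v)
| lterm_eq_addC t u : lterm_eq (LAdd t u) (LAdd u t)
| lterm_eq_add0 t : lterm_eq (LAdd LZero t) t
| lterm_eq_addN t : lterm_eq (LAdd (LScale (-1) t) t) LZero
| lterm_eq_scaleA a b t :
    lterm_eq (LScale a (LScale b t)) (LScale (a * b) t)
| lterm_eq_scale1 t : lterm_eq (LScale 1 t) t
| lterm_eq_scaleDr a t u :
    lterm_eq (LScale a (LAdd t u)) (LAdd (LScale a t) (LScale a u))
| lterm_eq_scaleDl a b t :
    lterm_eq (LScale (a + b) t) (LAdd (LScale a t) (LScale b t))
| lterm_eq_br_linearl a t u v :
    lterm_eq (LBr (LAdd (LScale a t) u) v) (LAdd (LScale a (LBr t v)) (LBr u v))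
| lterm_eq_br_linearr a t u v :
    lterm_eq (LBr v (LAdd (LScale a t) u)) (LAdd (LScale a (LBr v t)) (LBr v u))
| lterm_eq_brA t u v :
    lterm_eq (LBr t (LBr u v))
             (LAdd (LBr (LBr t u) v) (LScale (-1) (LBr (LBr t v) u))).

HB.instance Definition _ := gen_eqMixin lterm.
HB.instance Definition _ := gen_choiceMixin lterm.

Definition lterm_eqb : rel lterm := fun t u => `[< lterm_eq t u >].

Lemma lterm_eqb_equiv : equiv_class_of lterm_eqb.
Proof.
split=> [t|t u|u t v].
- exact/asboolP/lterm_eq_refl.
- by apply/asboolP/asboolP; apply: lterm_eq_sym.
- by move=> /asboolP tu /asboolP uv; apply/asboolP; exact: lterm_eq_trans uv.
Qed.

Canonical lterm_equiv := EquivRelPack lterm_eqb_equiv.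
Canonical lterm_encModRel := defaultEncModRel lterm_eqb.

Definition free_leib : Type := {eq_quot lterm_eqb}.
HB.instance Definition _ := Choice.on free_leib.

Definition free_leib_pi (t : lterm) : free_leib := \pi_({eq_quot lterm_eqb}) t.
Definition free_leib_repr (x : free_leib) : lterm := repr x.

Lemma free_leib_reprK : cancel free_leib_repr free_leib_pi.
Proof. exact: reprK. Qed.

Lemma free_leib_piP t u : free_leib_pi t = free_leib_pi u <-> lterm_eq t u.
Proof.
by split=> [/eqmodP/asboolP|tu] //; apply/eqmodP/asboolP.
Qed.

Definition free_leib_add (x y : free_leib) : free_leib :=
  free_leib_pi (LAdd (free_leib_repr x) (free_leib_repr y)).
Definition free_leib_scale (a : K) (x : free_leib) : free_leib :=
  free_leib_pi (LScale a (free_leib_repr x)).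
Definition free_leib_br (x y : free_leib) : free_leib :=
  free_leib_pi (LBr (free_leib_repr x) (free_leib_repr y)).

Lemma free_leib_piD t u :
  free_leib_pi (LAdd t u) = free_leib_add (free_leib_pi t) (free_leib_pi u).
Proof.
by apply/free_leib_piP; apply: lterm_eq_add; apply/free_leib_piP;
  rewrite free_leib_reprK.
Qed.

Lemma free_leib_piZ a t :
  free_leib_pi (LScale a t) = free_leib_scale a (free_leib_pi t).
Proof.
by apply/free_leib_piP; apply: lterm_eq_scale; apply/free_leib_piP;
  rewrite free_leib_reprK.
Qed.

Lemma free_leib_piB t u :
  free_leib_pi (LBr t u) = free_leib_br (free_leib_pi t) (free_leib_pi u).
Proof.
by apply/free_leib_piP; apply: lterm_eq_br; apply/free_leib_piP;
  rewrite free_leib_reprK.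
Qed.

Fact free_leib_addA : associative free_leib_add.
Proof.
move=> x y z.
rewrite -[x]free_leib_reprK -[y]free_leib_reprK -[z]free_leib_reprK.
by rewrite -!free_leib_piD; apply/free_leib_piP; apply: lterm_eq_addA.
Qed.

Fact free_leib_addC : commutative free_leib_add.
Proof.
move=> x y; rewrite -[x]free_leib_reprK -[y]free_leib_reprK -!free_leib_piD.
by apply/free_leib_piP; apply: lterm_eq_addC.
Qed.

Fact free_leib_add0 : left_id (free_leib_pi LZero) free_leib_add.
Proof.
move=> x; rewrite -[x]free_leib_reprK -!free_leib_piD.
by apply/free_leib_piP; apply: lterm_eq_add0.
Qed.

Fact free_leib_addN :
  left_inverse (free_leib_pi LZero) (free_leib_scale (-1)) free_leib_add.
Proof.
move=> x; rewrite -[x]free_leib_reprK -free_leib_piZ -!free_leib_piD.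
by apply/free_leib_piP; apply: lterm_eq_addN.
Qed.

HB.instance Definition _ := GRing.isZmodule.Build free_leib
  free_leib_addA free_leib_addC free_leib_add0 free_leib_addN.

Fact free_leib_scaleA a b (v : free_leib) :
  free_leib_scale a (free_leib_scale b v) = free_leib_scale (a * b) v.
Proof.
rewrite -[v]free_leib_reprK -!free_leib_piZ.
by apply/free_leib_piP; apply: lterm_eq_scaleA.
Qed.

Fact free_leib_scale1 : left_id 1 free_leib_scale.
Proof.
move=> v; rewrite -[v]free_leib_reprK -!free_leib_piZ.
by apply/free_leib_piP; apply: lterm_eq_scale1.
Qed.

Fact free_leib_scaleDr : right_distributive free_leib_scale +%R.
Proof.
move=> a u v; rewrite -[u]free_leib_reprK -[v]free_leib_reprK.
rewrite -[_ + _]free_leib_piD -!free_leib_piZ -[RHS]free_leib_piD.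
by apply/free_leib_piP; apply: lterm_eq_scaleDr.
Qed.

Fact free_leib_scaleDl v : {morph free_leib_scale^~ v : a b / a + b}.
Proof.
move=> a b /=; rewrite -[v]free_leib_reprK -!free_leib_piZ -[RHS]free_leib_piD.
by apply/free_leib_piP; apply: lterm_eq_scaleDl.
Qed.

HB.instance Definition _ := GRing.Zmodule_isLmodule.Build K free_leib
  free_leib_scaleA free_leib_scale1 free_leib_scaleDr free_leib_scaleDl.

Fact free_leib_br_linearl y : linear (fun x => free_leib_br x y).
Proof.
move=> a u v.
rewrite -[u]free_leib_reprK -[v]free_leib_reprK -[y]free_leib_reprK.
rewrite -[a *: free_leib_pi _]free_leib_piZ -[_ + _ in LHS]free_leib_piD.
rewrite -!free_leib_piB -[a *: _]free_leib_piZ -[RHS]free_leib_piD.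
by apply/free_leib_piP; apply: lterm_eq_br_linearl.
Qed.

Fact free_leib_br_linearr x : linear (free_leib_br x).
Proof.
move=> a u v.
rewrite -[u]free_leib_reprK -[v]free_leib_reprK -[x]free_leib_reprK.
rewrite -[a *: free_leib_pi _]free_leib_piZ -[_ + _ in LHS]free_leib_piD.
rewrite -!free_leib_piB -[a *: _]free_leib_piZ -[RHS]free_leib_piD.
by apply/free_leib_piP; apply: lterm_eq_br_linearr.
Qed.

Fact free_leib_brA x y z :
  free_leib_br x (free_leib_br y z) =
  free_leib_br (free_leib_br x y) z - free_leib_br (free_leib_br x z) y.
Proof.
rewrite -[x]free_leib_reprK -[y]free_leib_reprK -[z]free_leib_reprK.
rewrite -!free_leib_piB -[- _]free_leib_piZ -[RHS]free_leib_piD.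
by apply/free_leib_piP; apply: lterm_eq_brA.
Qed.

HB.instance Definition _ := Lmodule_isLeibniz.Build K free_leib
  free_leib_br_linearl free_leib_br_linearr free_leib_brA.

Definition free_leib_gen (x : X) : free_leib := free_leib_pi (LGen x).

Section Lift.
Variables (L : leibnizType K) (f : X -> L).

Fixpoint lterm_eval (t : lterm) : L :=
  match t with
  | LGen x => f x
  | LZero => 0
  | LAdd t u => lterm_eval t + lterm_eval u
  | LScale a t => a *: lterm_eval t
  | LBr t u => ⟦ lterm_eval t, lterm_eval u ⟧
  end.

Lemma lterm_eval_eq t u : lterm_eq t u -> lterm_eval t = lterm_eval u.
Proof.
elim=> //=; do ?by [move=> *; congruence].
- by move=> *; rewrite addrA.
- by move=> *; rewrite addrC.
- by move=> *; rewrite add0r.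
- by move=> *; rewrite scaleN1r addNr.
- by move=> *; rewrite scalerA.
- by move=> *; rewrite scale1r.
- by move=> *; rewrite scalerDr.
- by move=> *; rewrite scalerDl.
- by move=> *; rewrite leib_brDl leib_brZl.
- by move=> *; rewrite leib_brDr leib_brZr.
- by move=> *; rewrite leib_brA scaleN1r.
Qed.

Definition free_leib_lift (x : free_leib) : L := lterm_eval (free_leib_repr x).

Lemma free_leib_lift_pi t : free_leib_lift (free_leib_pi t) = lterm_eval t.
Proof.
by apply: lterm_eval_eq; apply/free_leib_piP; rewrite free_leib_reprK.
Qed.

Lemma free_leib_lift_linear : linear free_leib_lift.
Proof.
move=> a u v; rewrite -[u]free_leib_reprK -[v]free_leib_reprK.
rewrite -[a *: _]free_leib_piZ -[_ + _ in LHS]free_leib_piD.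
by rewrite !free_leib_lift_pi.
Qed.

HB.instance Definition _ := GRing.isLinear.Build K free_leib L _ free_leib_lift
  free_leib_lift_linear.

Lemma free_leib_lift_br : {morph free_leib_lift : x y / ⟦ x, y ⟧}.
Proof.
move=> u v; rewrite -[u]free_leib_reprK -[v]free_leib_reprK.
by rewrite -[⟦ _, _ ⟧ in LHS]free_leib_piB !free_leib_lift_pi.
Qed.

HB.instance Definition _ := isLeibnizMorphism.Build K free_leib L
  free_leib_lift free_leib_lift_br.

Lemma free_leib_lift_gen x : free_leib_lift (free_leib_gen x) = f x.
Proof. exact: free_leib_lift_pi. Qed.

End Lift.

End FreeLeibniz.

(* [lact m n] is the left action, usually written with m as a left exponent of
   n, and [ract n m] is the right action, written n^m. *)
Record leibAction (K : comPzRingType) (M N : leibnizType K) := LeibAction {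
  lact : M -> N -> N;
  ract : N -> M -> N;
  lact_linearl : forall n, linear (fun m => lact m n);
  lact_linearr : forall m, linear (lact m);
  ract_linearl : forall m, linear (fun n => ract n m);
  ract_linearr : forall n, linear (ract n);
  lact_br : forall m m' n,
    lact ⟦ m, m' ⟧ n = lact m (lact m' n) + ract (lact m n) m';
  br_lact : forall m n n',
    lact m ⟦ n, n' ⟧ = ⟦ lact m n, n' ⟧ - ⟦ lact m n', n ⟧;
  ract_br : forall m m' n,
    ract n ⟦ m, m' ⟧ = ract (ract n m) m' - ract (ract n m') m;
  br_ract : forall m n n',
    ract ⟦ n, n' ⟧ m = ⟦ ract n m, n' ⟧ + ⟦ n, ract n' m ⟧;
  lact_lact : forall m m' n, lact m (lact m' n) = - lact m (ract n m');
  br_lactr : forall m n n', ⟦ n, lact m n' ⟧ = - ⟦ n, ract n' m ⟧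
}.

Record crossedModule (K : comPzRingType) (m g : leibnizType K) :=
  CrossedModule {
  cm_map :> {leibniz m -> g};
  cm_act : leibAction g m;
  cm_lact : forall x a, cm_map (lact cm_act x a) = ⟦ x, cm_map a ⟧;
  cm_ract : forall a x, cm_map (ract cm_act a x) = ⟦ cm_map a, x ⟧;
  cm_peifferl : forall a b, lact cm_act (cm_map a) b = ⟦ a, b ⟧;
  cm_peifferr : forall a b, ract cm_act a (cm_map b) = ⟦ a, b ⟧
}.

(* The action of n on m through g; the action of m on n is obtained by
   exchanging eta and mu. *)
Section MutualActions.
Variables (K : comPzRingType) (g m n : leibnizType K).
Variables (eta : crossedModule m g) (mu : crossedModule n g).

Definition mut_lact (b : n) (a : m) : m := lact (cm_act eta) (mu b) a.
Definition mut_ract (a : m) (b : n) : m := ract (cm_act eta) a (mu b).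

End MutualActions.

Section Star.
Variables (K : comPzRingType) (g m n : leibnizType K).
Variables (eta : crossedModule m g) (mu : crossedModule n g).

(* [SymMN a b] stands for a * b and [SymNM b a] for b * a: the two families are
   kept apart, even when m and n coincide. *)
Inductive star_symbol : Type :=
| SymMN of m & n
| SymNM of n & m.

Local Notation F := (free_leib K star_symbol).
Local Notation mn a b := (free_leib_gen K (SymMN a b) : F).
Local Notation nm b a := (free_leib_gen K (SymNM b a) : F).

Local Notation lm := (mut_lact eta mu).
Local Notation rm := (mut_ract eta mu).
Local Notation ln := (mut_lact mu eta).
Local Notation rn := (mut_ract mu eta).

Inductive star_rel : F -> F -> Prop :=
| star_mn_linearl k a a' b : star_rel (mn (k *: a + a') b) (k *: mn a b + mn a' b)
| star_mn_linearr k a b b' : star_rel (mn a (k *: b + b')) (k *: mn a b + mn a b')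
| star_nm_linearl k b b' a : star_rel (nm (k *: b + b') a) (k *: nm b a + nm b' a)
| star_nm_linearr k b a a' : star_rel (nm b (k *: a + a')) (k *: nm b a + nm b a')
| star_mn_brr a b b' : star_rel (mn a ⟦ b, b' ⟧) (mn (rm a b) b' - mn (rm a b') b)
| star_nm_brr b a a' : star_rel (nm b ⟦ a, a' ⟧) (nm (rn b a) a' - nm (rn b a') a)
| star_mn_brl a a' b : star_rel (mn ⟦ a, a' ⟧ b) (nm (ln a b) a' - mn a (rn b a'))
| star_nm_brl b b' a : star_rel (nm ⟦ b, b' ⟧ a) (mn (lm b a) b' - nm b (rm a b'))
| star_mn_lact a a' b : star_rel (mn a (ln a' b)) (- mn a (rn b a'))
| star_nm_lact b b' a : star_rel (nm b (lm b' a)) (- nm b (rm a b'))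
| star_br_mn_mn1 a b a' b' :
    star_rel (mn (rm a b) (ln a' b')) ⟦ mn a b, mn a' b' ⟧
| star_br_mn_mn2 a b a' b' :
    star_rel ⟦ mn a b, mn a' b' ⟧ (nm (ln a b) (rm a' b'))
| star_br_nm_nm1 b a b' a' :
    star_rel (mn (lm b a) (rn b' a')) ⟦ nm b a, nm b' a' ⟧
| star_br_nm_nm2 b a b' a' :
    star_rel ⟦ nm b a, nm b' a' ⟧ (nm (rn b a) (lm b' a'))
| star_br_mn_nm1 a b b' a' :
    star_rel (mn (rm a b) (rn b' a')) ⟦ mn a b, nm b' a' ⟧
| star_br_mn_nm2 a b b' a' :
    star_rel ⟦ mn a b, nm b' a' ⟧ (nm (ln a b) (lm b' a'))
| star_br_nm_mn1 b a a' b' :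
    star_rel (mn (lm b a) (ln a' b')) ⟦ nm b a, mn a' b' ⟧
| star_br_nm_mn2 b a a' b' :
    star_rel ⟦ nm b a, mn a' b' ⟧ (nm (rn b a) (rm a' b')).

Definition star_relators : set F :=
  [set z | exists x y, star_rel x y /\ z = x - y].

Definition star : Type := leibq (ideal_gen star_relators).
HB.instance Definition _ := Leibniz.on star.

Definition star_pi : F -> star := @leibq_pi K F (ideal_gen star_relators).
HB.instance Definition _ := LeibnizMorphism.on star_pi.

Definition star_mn (a : m) (b : n) : star := star_pi (mn a b).
Definition star_nm (b : n) (a : m) : star := star_pi (nm b a).

Lemma star_pi_rel x y : star_rel x y -> star_pi x = star_pi y.
Proof.
by move=> xy; apply/leibq_piP; apply: ideal_gen_sub; exists x, y.
Qed.

Definition star_repr (x : star) : F := @leibq_repr K F (ideal_gen star_relators) x.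

Lemma star_reprK : cancel star_repr star_pi.
Proof. exact: leibq_reprK. Qed.

Section Lift.
Variables (L : leibnizType K) (f : star_symbol -> L).
Hypothesis f_rel : forall x y, star_rel x y ->
  free_leib_lift f x = free_leib_lift f y.

Definition star_lift (x : star) : L := free_leib_lift f (star_repr x).

Lemma star_lift_pi x : star_lift (star_pi x) = free_leib_lift f x.
Proof.
apply/eqP; rewrite -subr_eq0 -linearB; apply/eqP.
have /ideal_genP : star_repr (star_pi x) - x \in ideal_gen star_relators.
  by apply/leibq_piP; apply: star_reprK.
move=> H; apply: (H [set z | free_leib_lift f z = 0]).
- split=> [|k u v]; rewrite !inE /= ?linear0 //.
  by move=> fu fv; rewrite linearP /= fu fv scaler0 addr0.
- by move=> u v; rewrite !inE /= !leib_morph /= => ->; rewrite leib_br0l leib_br0r.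
- by move=> _ [u [v [uv ->]]] /=; rewrite linearB /= (f_rel uv) subrr.
Qed.

Lemma star_lift_linear : linear star_lift.
Proof.
move=> k u v; rewrite -[u]star_reprK -[v]star_reprK -linearP !star_lift_pi.
by rewrite linearP.
Qed.

Lemma star_lift_br : {morph star_lift : x y / ⟦ x, y ⟧}.
Proof.
move=> u v; rewrite -[u]star_reprK -[v]star_reprK -leib_morph !star_lift_pi.
by rewrite leib_morph.
Qed.

End Lift.

End Star.

Arguments star_mn {K g m n} eta mu a b.
Arguments star_nm {K g m n} eta mu b a.

Section MutualTheory.
Variables (K : comPzRingType) (g m n : leibnizType K).
Variables (eta : crossedModule m g) (mu : crossedModule n g).

Local Notation lm := (mut_lact eta mu).
Local Notation rm := (mut_ract eta mu).
Local Notation ln := (mut_lact mu eta).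
Local Notation rn := (mut_ract mu eta).

Lemma cm_lm b a : eta (lm b a) = ⟦ mu b, eta a ⟧.
Proof. exact: cm_lact. Qed.
Lemma cm_rm b a : eta (rm a b) = ⟦ eta a, mu b ⟧.
Proof. exact: cm_ract. Qed.

Lemma lm_rn b a c : lm (rn b a) c = ⟦ lm b a, c ⟧.
Proof. by rewrite /mut_lact /mut_ract cm_ract -cm_lact cm_peifferl. Qed.
Lemma lm_ln b a c : lm (ln a b) c = ⟦ rm a b, c ⟧.
Proof. by rewrite /mut_lact /mut_ract cm_lact -cm_ract cm_peifferl. Qed.
Lemma rm_rn b a c : rm c (rn b a) = ⟦ c, lm b a ⟧.
Proof. by rewrite /mut_lact /mut_ract cm_ract -cm_lact cm_peifferr. Qed.
Lemma rm_ln b a c : rm c (ln a b) = ⟦ c, rm a b ⟧.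
Proof. by rewrite /mut_lact /mut_ract cm_lact -cm_ract cm_peifferr. Qed.

Lemma lm_linearl k b b' a : lm (k *: b + b') a = k *: lm b a + lm b' a.
Proof. by rewrite /mut_lact linearP lact_linearl. Qed.
Lemma lm_linearr k b a a' : lm b (k *: a + a') = k *: lm b a + lm b a'.
Proof. exact: lact_linearr. Qed.
Lemma rm_linearl k a a' b : rm (k *: a + a') b = k *: rm a b + rm a' b.
Proof. exact: ract_linearl. Qed.
Lemma rm_linearr k a b b' : rm a (k *: b + b') = k *: rm a b + rm a b'.
Proof. by rewrite /mut_ract linearP ract_linearr. Qed.

Lemma rm_brr a b b' : rm a ⟦ b, b' ⟧ = rm (rm a b) b' - rm (rm a b') b.
Proof. by rewrite /mut_ract leib_morph ract_br. Qed.
Lemma rm_brl a a' b : rm ⟦ a, a' ⟧ b = ⟦ rm a b, a' ⟧ + ⟦ a, rm a' b ⟧.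
Proof. exact: br_ract. Qed.
Lemma lm_brr b a a' : lm b ⟦ a, a' ⟧ = ⟦ lm b a, a' ⟧ - ⟦ lm b a', a ⟧.
Proof. exact: br_lact. Qed.
Lemma lm_brl b b' a : lm ⟦ b, b' ⟧ a = lm b (lm b' a) + rm (lm b a) b'.
Proof. by rewrite /mut_lact /mut_ract leib_morph lact_br. Qed.
Lemma lm_lm b b' a : lm b (lm b' a) = - lm b (rm a b').
Proof. exact: lact_lact. Qed.
Lemma br_lmr b a a' : ⟦ a, lm b a' ⟧ = - ⟦ a, rm a' b ⟧.
Proof. exact: br_lactr. Qed.

End MutualTheory.

Section Tau.
Variables (K : comPzRingType) (g m n : leibnizType K).
Variables (eta : crossedModule m g) (mu : crossedModule n g).

Definition tau_m_sym (s : star_symbol m n) : m :=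
  match s with
  | SymMN a b => mut_ract eta mu a b
  | SymNM b a => mut_lact eta mu b a
  end.

Definition tau_n_sym (s : star_symbol m n) : n :=
  match s with
  | SymMN a b => mut_lact mu eta a b
  | SymNM b a => mut_ract mu eta b a
  end.

Lemma tau_m_rel x y : star_rel eta mu x y ->
  free_leib_lift tau_m_sym x = free_leib_lift tau_m_sym y.
Proof.
case=> *; rewrite ?(linearP, linearB, linearN, leib_morph) /=;
  rewrite !free_leib_lift_gen /=.
- exact: rm_linearl.
- exact: rm_linearr.
- exact: lm_linearl.
- exact: lm_linearr.
- exact: rm_brr.
- by rewrite !lm_rn lm_brr.
- by rewrite lm_ln rm_rn rm_brl br_lmr opprK.
- by rewrite lm_brl lm_lm addrC.
- by rewrite rm_ln rm_rn br_lmr opprK.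
- exact: lm_lm.
- by rewrite rm_ln.
- by rewrite lm_ln.
- by rewrite rm_rn.
- by rewrite lm_rn.
- by rewrite rm_rn.
- by rewrite lm_ln.
- by rewrite rm_ln.
- by rewrite lm_rn.
Qed.

Lemma tau_n_rel x y : star_rel eta mu x y ->
  free_leib_lift tau_n_sym x = free_leib_lift tau_n_sym y.
Proof.
case=> *; rewrite ?(linearP, linearB, linearN, leib_morph) /=;
  rewrite !free_leib_lift_gen /=.
- exact: lm_linearl.
- exact: lm_linearr.
- exact: rm_linearl.
- exact: rm_linearr.
- by rewrite !lm_rn lm_brr.
- exact: rm_brr.
- by rewrite lm_brl lm_lm addrC.
- by rewrite lm_ln rm_rn rm_brl br_lmr opprK.
- exact: lm_lm.
- by rewrite rm_ln rm_rn br_lmr opprK.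
- by rewrite lm_rn.
- by rewrite rm_rn.
- by rewrite lm_ln.
- by rewrite rm_ln.
- by rewrite lm_rn.
- by rewrite rm_ln.
- by rewrite lm_ln.
- by rewrite rm_rn.
Qed.

Definition tau_m : star eta mu -> m := star_lift tau_m_sym.
Definition tau_n : star eta mu -> n := star_lift tau_n_sym.

HB.instance Definition _ := GRing.isLinear.Build K (star eta mu) m _ tau_m
  (star_lift_linear tau_m_rel).
HB.instance Definition _ := isLeibnizMorphism.Build K (star eta mu) m tau_m
  (star_lift_br tau_m_rel).
HB.instance Definition _ := GRing.isLinear.Build K (star eta mu) n _ tau_n
  (star_lift_linear tau_n_rel).
HB.instance Definition _ := isLeibnizMorphism.Build K (star eta mu) n tau_n
  (star_lift_br tau_n_rel).

Lemma tau_m_mn a b : tau_m (star_mn eta mu a b) = mut_ract eta mu a b.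
Proof. by rewrite /tau_m (star_lift_pi tau_m_rel) free_leib_lift_gen. Qed.
Lemma tau_m_nm b a : tau_m (star_nm eta mu b a) = mut_lact eta mu b a.
Proof. by rewrite /tau_m (star_lift_pi tau_m_rel) free_leib_lift_gen. Qed.
Lemma tau_n_mn a b : tau_n (star_mn eta mu a b) = mut_lact mu eta a b.
Proof. by rewrite /tau_n (star_lift_pi tau_n_rel) free_leib_lift_gen. Qed.
Lemma tau_n_nm b a : tau_n (star_nm eta mu b a) = mut_ract mu eta b a.
Proof. by rewrite /tau_n (star_lift_pi tau_n_rel) free_leib_lift_gen. Qed.

Lemma star_ind (P : star eta mu -> Prop) :
  (forall a b, P (star_mn eta mu a b)) -> (forall b a, P (star_nm eta mu b a)) ->
  P 0 -> (forall x y, P x -> P y -> P (x + y)) ->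
  (forall k x, P x -> P (k *: x)) ->
  (forall x y, P x -> P y -> P ⟦ x, y ⟧) -> forall x, P x.
Proof.
move=> Pmn Pnm P0 PD PZ PB x; rewrite -[x]star_reprK -[star_repr x]free_leib_reprK.
elim: (free_leib_repr _) => [[a b|b a]||t Pt u Pu|k t Pt|t Pt u Pu].
- exact: Pmn.
- exact: Pnm.
- by rewrite [free_leib_pi _](_ : _ = 0) // linear0.
- by rewrite [free_leib_pi _]free_leib_piD linearD; apply: PD.
- by rewrite [free_leib_pi _]free_leib_piZ linearZ; apply: PZ.
- by rewrite [free_leib_pi _]free_leib_piB leib_morph; apply: PB.
Qed.

Lemma eta_tau_m x : eta (tau_m x) = mu (tau_n x).
Proof.
elim/star_ind: x => [a b|b a||x y Ex Ey|k x Ex|x y Ex Ey].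
- by rewrite tau_m_mn tau_n_mn cm_rm cm_lm.
- by rewrite tau_m_nm tau_n_nm cm_rm cm_lm.
- by rewrite !linear0.
- by rewrite !linearD /= Ex Ey.
- by rewrite !linearZ /= Ex.
- by rewrite !leib_morph /= Ex Ey.
Qed.

End Tau.

Section Wedge.
Variables (K : comPzRingType) (g m n : leibnizType K).
Variables (eta : crossedModule m g) (mu : crossedModule n g).

(* [box] is the submodule usually written m □ n. *)
Definition box_gens : set (star eta mu) :=
  [set z | exists a b a' b', [/\ eta a = mu b, eta a' = mu b' &
    z = star_mn eta mu a b' - star_nm eta mu b a']].

Definition box : {pred star eta mu} := span box_gens.

HB.instance Definition _ := GRing.SubmodClosed.on box.

Lemma star_br_mn_mn a b a' b' :
  ⟦ star_mn eta mu a b, star_mn eta mu a' b' ⟧ =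
  star_mn eta mu (mut_ract eta mu a b) (mut_lact mu eta a' b').
Proof. by rewrite -[LHS]leib_morph; apply/esym/star_pi_rel; constructor. Qed.
Lemma star_br_mn_nm a b b' a' :
  ⟦ star_mn eta mu a b, star_nm eta mu b' a' ⟧ =
  star_mn eta mu (mut_ract eta mu a b) (mut_ract mu eta b' a').
Proof. by rewrite -[LHS]leib_morph; apply/esym/star_pi_rel; constructor. Qed.
Lemma star_br_nm_mn b a a' b' :
  ⟦ star_nm eta mu b a, star_mn eta mu a' b' ⟧ =
  star_mn eta mu (mut_lact eta mu b a) (mut_lact mu eta a' b').
Proof. by rewrite -[LHS]leib_morph; apply/esym/star_pi_rel; constructor. Qed.
Lemma star_br_nm_nm b a b' a' :
  ⟦ star_nm eta mu b a, star_nm eta mu b' a' ⟧ =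
  star_mn eta mu (mut_lact eta mu b a) (mut_ract mu eta b' a').
Proof. by rewrite -[LHS]leib_morph; apply/esym/star_pi_rel; constructor. Qed.

Lemma box_gens_central z y : box_gens z -> ⟦ z, y ⟧ = 0 /\ ⟦ y, z ⟧ = 0.
Proof.
move=> [a [b [a' [b' [ab ab' ->]]]]]; set z' := _ - _.
have rl : mut_ract eta mu a b' = mut_lact eta mu b a'.
  by rewrite /mut_ract /mut_lact -ab' -ab cm_peifferr cm_peifferl.
have lr : mut_lact mu eta a b' = mut_ract mu eta b a'.
  by rewrite /mut_ract /mut_lact ab' ab cm_peifferr cm_peifferl.
elim/star_ind: y => [c d|d c||x y [xl xr] [yl yr]|k x [xl xr]|x y [xl xr] [yl yr]].
- rewrite leib_brDl leib_brNl leib_brDr leib_brNr.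
  rewrite star_br_mn_mn star_br_nm_mn star_br_mn_mn star_br_mn_nm.
  by rewrite rl lr !subrr.
- rewrite leib_brDl leib_brNl leib_brDr leib_brNr.
  rewrite star_br_mn_nm star_br_nm_nm star_br_nm_mn star_br_nm_nm.
  by rewrite rl lr !subrr.
- by rewrite leib_br0l leib_br0r.
- by rewrite (leib_brDl x) (leib_brDr z') xl xr yl yr !addr0.
- by rewrite (leib_brZl k x) (leib_brZr k x) xl xr scaler0.
- have zl : ⟦ z', ⟦ x, y ⟧ ⟧ = 0.
    by rewrite leib_brA xl yl !leib_br0l subrr.
  split=> //; have := leib_brA x y z'.
  by rewrite yr leib_br0r xr leib_br0l subr0.
Qed.

Lemma box_central x y : x \in box -> ⟦ x, y ⟧ = 0 /\ ⟦ y, x ⟧ = 0.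
Proof.
move=> /spanP bx; move: y.
apply: (bx [set x | forall y, ⟦ x, y ⟧ = 0 /\ ⟦ y, x ⟧ = 0]).
- split=> [|k u v]; rewrite !inE /=.
    by move=> y; rewrite leib_br0l leib_br0r.
  move=> cu cv y; have [uy yu] := cu y; have [vy yv] := cv y.
  rewrite leib_brDl leib_brDr leib_brZl leib_brZr uy yu vy yv.
  by rewrite scaler0 addr0.
- by move=> z gz y; apply: box_gens_central.
Qed.

Lemma box_ideal_closed : leib_ideal_closed box.
Proof. by move=> x y /(box_central y) [-> ->]; rewrite rpred0. Qed.

HB.instance Definition _ :=
  isLeibnizIdeal.Build K (star eta mu) box box_ideal_closed.

Definition wedge : Type := leibq box.
HB.instance Definition _ := Leibniz.on wedge.

Definition wedge_pi : star eta mu -> wedge := @leibq_pi K (star eta mu) box.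
HB.instance Definition _ := LeibnizMorphism.on wedge_pi.

End Wedge.

Arguments box {K g m n} eta mu.
Arguments wedge_pi {K g m n} eta mu.

Section Pullback.
Variables (K : comPzRingType) (g m n : leibnizType K).
Variables (eta : crossedModule m g) (mu : crossedModule n g).

Definition pullback_pred : {pred (m * n)%type} :=
  fun p => eta p.1 == mu p.2.

Lemma pullback_submod_closed : GRing.submod_closed pullback_pred.
Proof.
split=> [|k u v]; rewrite !unfold_in /= ?linear0 ?eqxx //.
by move=> /eqP uE /eqP vE; rewrite !linearP /= uE vE.
Qed.

HB.instance Definition _ := GRing.isSubmodClosed.Build K (m * n)%type
  pullback_pred (GRing.submod_closed_semi pullback_submod_closed).

Record pullback : Type := Pullback {
  pullback_val :> (m * n)%type;
  pullback_valP : pullback_val \in pullback_pred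
}.

HB.instance Definition _ := [isSub for pullback_val].
HB.instance Definition _ := [Choice of pullback by <:].
HB.instance Definition _ := [SubChoice_isSubLmodule of pullback by <:].

(* [angle] is usually written <m, n>. It is the whole image of (tau_m, tau_n),
   since that image lies in the pullback by [eta_tau_m]. *)
Definition angle : {pred pullback} := fun p =>
  `[< exists x : star eta mu, pullback_val p = (tau_m x, tau_n x) >].

Lemma angle_submod_closed : GRing.submod_closed angle.
Proof.
split; first by apply/asboolP; exists 0; rewrite !linear0.
move=> k u v /asboolP [x ux] /asboolP [y vy]; apply/asboolP.
by exists (k *: x + y); rewrite !linearP /= [val u]ux [val v]vy.
Qed.

HB.instance Definition _ := GRing.isSubmodClosed.Build K pullback angle
  (GRing.submod_closed_semi angle_submod_closed).

Definition pullbackq : Type := modq angle.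
HB.instance Definition _ := GRing.Lmodule.on pullbackq.

Definition pullbackq_pi : pullback -> pullbackq := @modq_pi K pullback angle.
HB.instance Definition _ := GRing.Linear.on pullbackq_pi.

End Pullback.

Section Gamma.
Variables (K : comPzRingType) (A : lmodType K).

Local Notation F := (free_mod K A).
Local Notation gg a := (free_mod_gen K a : F).

Inductive gamma_rel : F -> F -> Prop :=
| gamma_sqr k a : gamma_rel (k ^+ 2 *: gg a) (gg (k *: a))
| gamma_add3 a b c : gamma_rel
    (gg (a + b + c) + gg a + gg b + gg c) (gg (a + b) + gg (a + c) + gg (b + c))
| gamma_scale k a b : gamma_rel
    (gg (k *: a + b) + k *: gg a + k *: gg b)
    (k *: gg (a + b) + gg (k *: a) + gg b).

Definition gamma_relators : set F :=
  [set z | exists x y, gamma_rel x y /\ z = x - y].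

Definition Gamma : Type := modq (span gamma_relators).
HB.instance Definition _ := GRing.Lmodule.on Gamma.

Definition gamma (a : A) : Gamma := @modq_pi K F (span gamma_relators) (gg a).

Definition Gamma_br (x y : Gamma) : Gamma := 0.

Fact Gamma_br_linearl y : linear (fun x => Gamma_br x y).
Proof. by move=> k u v; rewrite /Gamma_br scaler0 addr0. Qed.

Fact Gamma_br_linearr x : linear (Gamma_br x).
Proof. by move=> k u v; rewrite /Gamma_br scaler0 addr0. Qed.

Fact Gamma_brA x y z :
  Gamma_br x (Gamma_br y z) = Gamma_br (Gamma_br x y) z - Gamma_br (Gamma_br x z) y.
Proof. by rewrite /Gamma_br subr0. Qed.

HB.instance Definition _ := Lmodule_isLeibniz.Build K Gamma
  Gamma_br_linearl Gamma_br_linearr Gamma_brA.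

End Gamma.

Definition leib_exact (K : comPzRingType) (L M N : leibnizType K)
    (f : {leibniz L -> M}) (h : {leibniz M -> N}) : Prop :=
  range f = [set x | h x = 0].

(* Main.v *)
(** Write [cross p p'] for m * n' - n * m', where p = (m, n) and p' = (m', n')
    lie in the pullback.  Over g the elements m and n act in the same way, so
    the actions occurring in the defining relations of the star product turn
    into brackets; the relations then make [cross] vanish as soon as one of its
    arguments is the image of a generator of the star product.  Brackets need no
    separate argument, since the image of [x, y] is also that of the generator
    tau_m x * tau_n y.  Hence [cross] descends to a bilinear map on the
    quotient by <m, n>, and (x, y) |-> cross x y is quadratic, so it factors
    through Gamma.  Its values generate the box, whose centrality makes the
    factorization a Leibniz homomorphism. *)
Require Import Defs.
From HB Require Import structures.
From mathcomp Require Import all_boot all_order all_algebra.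
From mathcomp Require Import boolp classical_sets.

Set Implicit Arguments.
Unset Strict Implicit.
Unset Printing Implicit Defensive.

Import GRing.Theory.
Local Open Scope classical_set_scope.
Local Open Scope ring_scope.

(** * Linear maps out of Gamma *)

Section GammaLift.
Variables (K : comPzRingType) (A V : lmodType K) (q : A -> V).
Hypothesis q_sqr : forall k a, k ^+ 2 *: q a = q (k *: a).
Hypothesis q_add3 : forall a b c,
  q (a + b + c) + q a + q b + q c = q (a + b) + q (a + c) + q (b + c).
Hypothesis q_scale : forall k a b,
  q (k *: a + b) + k *: q a + k *: q b = k *: q (a + b) + q (k *: a) + q b.

Local Notation F := (free_mod K A).
Local Notation relators := (Defs.span (@gamma_relators K A)).

(** Evaluated on a chosen representative; quadraticity of [q] enters in proving independence of the
    choice. *)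
Definition gamma_lift (x : Gamma A) : V :=
  free_mod_lift q (@modq_repr K F relators x).

(** The kernel of [free_mod_lift q] is a submodule, and it contains the relators because [q] is
    quadratic; hence it contains their span. *)
Lemma gamma_lift_pi (z : F) :
  gamma_lift (@modq_pi K F relators z) = free_mod_lift q z.
Proof.
apply/eqP; rewrite -subr_eq0 -linearB; apply/eqP.
set w := _ - z.
have /spanP ker_w : w \in relators by apply/modq_piP; rewrite modq_reprK.
apply: (ker_w [set z | free_mod_lift q z = 0]) => [|_ [u [v [uv ->]]]].
  split=> [|k u v]; rewrite !inE /= ?linear0 //.
  by move=> qu qv; rewrite linearP /= qu qv scaler0 addr0.
rewrite /= linearB; apply/eqP; rewrite subr_eq0; apply/eqP.
by case: uv => *; rewrite ?(linearD, linearZ) /= !free_mod_lift_gen.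
Qed.

Lemma gamma_lift_linear : linear gamma_lift.
Proof.
move=> k u v; rewrite -[u](@modq_reprK K F) -[v](@modq_reprK K F).
by rewrite -linearP !gamma_lift_pi linearP.
Qed.

Lemma gamma_lift_gamma a : gamma_lift (gamma a) = q a.
Proof. by rewrite gamma_lift_pi free_mod_lift_gen. Qed.

End GammaLift.

Lemma Gamma_ind (K : comPzRingType) (A : lmodType K) (P : Gamma A -> Prop) :
  P 0 -> (forall x y, P x -> P y -> P (x + y)) ->
  (forall k x, P x -> P (k *: x)) -> (forall a, P (gamma a)) -> forall x, P x.
Proof.
move=> P0 PD PZ Pg x.
rewrite -[x](@modq_reprK K (free_mod K A)) -[modq_repr x]free_mod_reprK.
elim: (free_mod_repr _) => [a||t Pt u Pu|k t Pt].
- exact: Pg.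
- by rewrite [free_mod_pi _](_ : _ = 0) // linear0.
- by rewrite [free_mod_pi _]free_mod_piD linearD; apply: PD.
- by rewrite [free_mod_pi _]free_mod_piZ linearZ; apply: PZ.
Qed.

(** * Quadratic maps from bilinear ones *)

Section BilinearQuadratic.
Variables (K : comPzRingType) (A B V : lmodType K) (f : A -> B -> V).
Hypothesis f_linearl : forall b, linear (f^~ b).
Hypothesis f_linearr : forall a, linear (f a).

Let fDl a a' b : f (a + a') b = f a b + f a' b.
Proof. by have := f_linearl b 1 a a'; rewrite !scale1r. Qed.
Let fDr a b b' : f a (b + b') = f a b + f a b'.
Proof. by have := f_linearr a 1 b b'; rewrite !scale1r. Qed.
Let f0l b : f 0 b = 0.
Proof. by apply: (addIr (f 0 b)); rewrite -fDl !add0r. Qed.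
Let f0r a : f a 0 = 0.
Proof. by apply: (addIr (f a 0)); rewrite -fDr !add0r. Qed.
Let fZl k a b : f (k *: a) b = k *: f a b.
Proof. by have := f_linearl b k a 0; rewrite f0l !addr0. Qed.
Let fZr k a b : f a (k *: b) = k *: f a b.
Proof. by have := f_linearr a k b 0; rewrite f0r !addr0. Qed.

Let q (p : A * B) : V := f p.1 p.2.

Lemma bilinear_sqr k p : k ^+ 2 *: q p = q (k *: p).
Proof. by rewrite /q /= fZl fZr scalerA -expr2. Qed.

Lemma bilinear_add3 p1 p2 p3 :
  q (p1 + p2 + p3) + q p1 + q p2 + q p3
  = q (p1 + p2) + q (p1 + p3) + q (p2 + p3).
Proof.
rewrite /q /= !(fDl, fDr) !addrA.
(* Both sides are now sums of the same twelve values of [f], in different orders. *)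
by rewrite [LHS](ACl (1*2*4*5*10*3*7*9*11*6*8*12)).
Qed.

Lemma bilinear_scale k p1 p2 :
  q (k *: p1 + p2) + k *: q p1 + k *: q p2
  = k *: q (p1 + p2) + q (k *: p1) + q p2.
Proof.
rewrite /q /= !(fDl, fDr, fZl, fZr, scalerDr) !addrA.
by rewrite [LHS](ACl (5*2*3*6*1*4)).
Qed.

End BilinearQuadratic.

(** * The relations of the star product as identities between its elements *)

Section Cross.
Variables (K : comPzRingType) (g m n : leibnizType K).
Variables (eta : crossedModule m g) (mu : crossedModule n g).

Local Notation lm := (mut_lact eta mu).
Local Notation rm := (mut_ract eta mu).
Local Notation ln := (mut_lact mu eta).
Local Notation rn := (mut_ract mu eta).
Local Notation mn := (star_mn eta mu).
Local Notation nm := (star_nm eta mu).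

Lemma mn_linearl b : linear (mn^~ b).
Proof. by move=> k a a'; rewrite -[RHS]linearP; apply: star_pi_rel; constructor. Qed.
Lemma mn_linearr a : linear (mn a).
Proof. by move=> k b b'; rewrite -[RHS]linearP; apply: star_pi_rel; constructor. Qed.
Lemma nm_linearl a : linear (nm^~ a).
Proof. by move=> k b b'; rewrite -[RHS]linearP; apply: star_pi_rel; constructor. Qed.
Lemma nm_linearr b : linear (nm b).
Proof. by move=> k a a'; rewrite -[RHS]linearP; apply: star_pi_rel; constructor. Qed.
Lemma mn_brr a b b' : mn a ⟦ b, b' ⟧ = mn (rm a b) b' - mn (rm a b') b.
Proof. by rewrite -[RHS]linearB; apply: star_pi_rel; constructor. Qed.
Lemma nm_brr b a a' : nm b ⟦ a, a' ⟧ = nm (rn b a) a' - nm (rn b a') a.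
Proof. by rewrite -[RHS]linearB; apply: star_pi_rel; constructor. Qed.
Lemma mn_brl a a' b : mn ⟦ a, a' ⟧ b = nm (ln a b) a' - mn a (rn b a').
Proof. by rewrite -[RHS]linearB; apply: star_pi_rel; constructor. Qed.
Lemma nm_brl b b' a : nm ⟦ b, b' ⟧ a = mn (lm b a) b' - nm b (rm a b').
Proof. by rewrite -[RHS]linearB; apply: star_pi_rel; constructor. Qed.
Lemma mn_lact a a' b : mn a (ln a' b) = - mn a (rn b a').
Proof. by rewrite -[RHS]linearN; apply: star_pi_rel; constructor. Qed.
Lemma nm_lact b b' a : nm b (lm b' a) = - nm b (rm a b').
Proof. by rewrite -[RHS]linearN; apply: star_pi_rel; constructor. Qed.

(** * Consequences for a pair with equal images in [g] *)

Section EqualImages.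
Variables (a : m) (b : n).
Hypothesis ab : eta a = mu b.

Lemma rm_pull c : rm c b = ⟦ c, a ⟧.
Proof. by rewrite /mut_ract -ab cm_peifferr. Qed.
Lemma lm_pull c : lm b c = ⟦ a, c ⟧.
Proof. by rewrite /mut_lact -ab cm_peifferl. Qed.
Lemma rn_pull d : rn d a = ⟦ d, b ⟧.
Proof. by rewrite /mut_ract ab cm_peifferr. Qed.
Lemma ln_pull d : ln a d = ⟦ b, d ⟧.
Proof. by rewrite /mut_lact ab cm_peifferl. Qed.

(** Since [⟦d, b⟧ = rn d a], the element [mn c ⟦d, b⟧] can be expanded by its own bracket or read
    off from the expansion of [mn ⟦c, a⟧ d]; the two results are compared. *)
Lemma cross_mn_l c d : mn (rm c d) b = nm (ln c d) a.
Proof.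
apply: (addIr (- mn ⟦ c, a ⟧ d)).
by rewrite -{1}rm_pull -mn_brr -rn_pull mn_brl subKr.
Qed.

(** The same comparison for [nm ⟦d, b⟧ c], which also occurs in the expansion of [nm d ⟦c, a⟧]. *)
Lemma cross_nm_l d c : mn (lm d c) b = nm (rn d c) a.
Proof.
apply: (addIr (- nm d ⟦ c, a ⟧)).
by rewrite -{1}rm_pull -nm_brl -rn_pull nm_brr subKr.
Qed.

(** As [⟦b, d⟧ = ln a d] and [⟦a, c⟧ = lm b c], adding [nm ⟦b, d⟧ c] turns both sides into
    [mn ⟦a, c⟧ d]; the sign rule [mn_lact] makes the left side fit [mn_brl]. *)
Lemma cross_mn_r c d : mn a (ln c d) = nm b (rm c d).
Proof.
apply: (addrI (nm ⟦ b, d ⟧ c)).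
by rewrite -{1}ln_pull mn_lact -mn_brl nm_brl lm_pull subrK.
Qed.

Lemma cross_nm_r d c : mn a (rn d c) = nm b (lm d c).
Proof.
by rewrite nm_lact -cross_mn_r mn_lact opprK.
Qed.

End EqualImages.

(** * The pairing on the pullback and its vanishing on [angle] *)

Definition cross (p p' : pullback eta mu) : star eta mu :=
  mn p.1 p'.2 - nm p.2 p'.1.

Lemma cross_linearl p' : linear (cross^~ p').
Proof.
move=> k p q; rewrite /cross /= mn_linearl nm_linearl scalerBr opprD.
by rewrite addrACA.
Qed.

Lemma cross_linearr p : linear (cross p).
Proof.
move=> k q q'; rewrite /cross /= mn_linearr nm_linearr scalerBr opprD.
by rewrite addrACA.
Qed.

Lemma tau_ind (P : m -> n -> Prop) :
  (forall a b, P (rm a b) (ln a b)) -> (forall b a, P (lm b a) (rn b a)) ->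
  (forall k a b a' b', P a b -> P a' b' -> P (k *: a + a') (k *: b + b')) ->
  forall x : star eta mu, P (tau_m x) (tau_n x).
Proof.
move=> Pmn Pnm PL; have P0 : P 0 0.
  (* The scalar -1 cancels the generator pair at [(0, 0)] against itself. *)
  by have := PL (-1) _ _ _ _ (Pmn 0 0) (Pmn 0 0); rewrite !scaleN1r !addNr.
elim/star_ind => [a b|b a||x y Px Py|k x Px|x y _ _].
- by rewrite tau_m_mn tau_n_mn.
- by rewrite tau_m_nm tau_n_nm.
- by rewrite !linear0.
- by rewrite !linearD /= -[tau_m x]scale1r -[tau_n x]scale1r; apply: PL.
- by rewrite !linearZ /= -[X in P X]addr0 -[X in P _ X]addr0; apply: PL.
(* The bracket is the image of the generator [mn (tau_m x) (tau_n y)], so no induction hypothesis is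
   used. *)
rewrite !leib_morph -(rm_pull (eta_tau_m y)) -(ln_pull (eta_tau_m x)).
exact: Pmn.
Qed.

Lemma cross_anglel p p' : p \in @angle K g m n eta mu -> cross p p' = 0.
Proof.
move=> /asboolP [x]; rewrite /cross => ->; have /eqP p'E := pullback_valP p'.
apply/eqP; rewrite subr_eq0; apply/eqP.
apply: (@tau_ind (fun a b => mn a p'.2 = nm b p'.1)) => [a b|b a|k a b a' b'].
- exact: cross_mn_l.
- exact: cross_nm_l.
- by rewrite mn_linearl nm_linearl => -> ->.
Qed.

Lemma cross_angler p p' : p' \in @angle K g m n eta mu -> cross p p' = 0.
Proof.
move=> /asboolP [x]; rewrite /cross => ->; have /eqP pE := pullback_valP p.
apply/eqP; rewrite subr_eq0; apply/eqP.
apply: (@tau_ind (fun a b => mn p.1 b = nm p.2 a)) => [a b|b a|k a b a' b'].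
- exact: cross_mn_r.
- exact: cross_nm_r.
- by rewrite mn_linearr nm_linearr => -> ->.
Qed.

(** * Descent of the pairing to the quotient *)

Definition crossq (x y : pullbackq eta mu) : star eta mu :=
  cross (modq_repr x) (modq_repr y).

(** The chosen representatives differ from [p] and [p'] by elements of [angle], which [cross] kills
    on either side. *)
Lemma crossq_pi p p' : crossq (pullbackq_pi p) (pullbackq_pi p') = cross p p'.
Proof.
rewrite /crossq; set r := modq_repr _; set r' := modq_repr _.
have rp : r - p \in @angle K g m n eta mu by apply/modq_piP; rewrite modq_reprK.
have rp' : r' - p' \in @angle K g m n eta mu by apply/modq_piP; rewrite modq_reprK.
rewrite -[r](subrK p) -[r'](subrK p').
rewrite -[r - p]scale1r cross_linearl cross_anglel // scaler0 add0r.
by rewrite -[r' - p']scale1r cross_linearr cross_angler // scaler0 add0r.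
Qed.

Lemma crossq_linearl y : linear (crossq^~ y).
Proof.
move=> k u v; rewrite -[u]modq_reprK -[v]modq_reprK -[y]modq_reprK.
by rewrite -linearP !crossq_pi cross_linearl.
Qed.

Lemma crossq_linearr x : linear (crossq x).
Proof.
move=> k u v; rewrite -[u]modq_reprK -[v]modq_reprK -[x]modq_reprK.
by rewrite -linearP !crossq_pi cross_linearr.
Qed.

Lemma cross_box p p' : cross p p' \in box eta mu.
Proof.
apply/spanP => M _; apply; exists p.1, p.2, p'.1, p'.2.
by split=> //; apply/eqP; exact: pullback_valP.
Qed.

(** * The homomorphism from Gamma and its image *)

Local Notation Q := (pullbackq eta mu).

Definition psi : Gamma (Q * Q)%type -> star eta mu :=
  gamma_lift (fun xy => crossq xy.1 xy.2).

Lemma psi_linear : linear psi.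
Proof.
apply: gamma_lift_linear => *.
- exact: (bilinear_sqr crossq_linearl crossq_linearr).
- exact: (bilinear_add3 crossq_linearl crossq_linearr).
- exact: (bilinear_scale crossq_linearl crossq_linearr).
Qed.

HB.instance Definition _ := GRing.isLinear.Build K (Gamma (Q * Q)%type)
  (star eta mu) _ psi psi_linear.

Lemma psi_gamma p p' :
  psi (gamma (pullbackq_pi p, pullbackq_pi p')) = cross p p'.
Proof.
rewrite [LHS]gamma_lift_gamma ?crossq_pi // => *.
- exact: (bilinear_sqr crossq_linearl crossq_linearr).
- exact: (bilinear_add3 crossq_linearl crossq_linearr).
- exact: (bilinear_scale crossq_linearl crossq_linearr).
Qed.

Lemma psi_box x : psi x \in box eta mu.
Proof.
elim/Gamma_ind: x => [|x y xb yb|k x xb|[x y]].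
- by rewrite linear0 rpred0.
- by rewrite linearD rpredD.
- by rewrite linearZ rpredZ.
by rewrite -[x]modq_reprK -[y]modq_reprK psi_gamma cross_box.
Qed.

(** Both sides vanish: Gamma is abelian and the values of [psi] are central. *)
Lemma psi_br : {morph psi : x y / ⟦ x, y ⟧}.
Proof.
move=> x y; have [-> _] := box_central (psi y) (psi_box x).
exact: linear0.
Qed.

HB.instance Definition _ := isLeibnizMorphism.Build K (Gamma (Q * Q)%type)
  (star eta mu) psi psi_br.

Lemma range_psi : range psi = [set x | x \in box eta mu].
Proof.
apply/seteqP; split => [_ [x _ <-]|x /spanP /(_ (range psi))]; first exact: psi_box.
apply=> [|_ [a [b [a' [b' [ab ab' ->]]]]]].
  (* By linearity the range is a submodule, so it contains the span of any generators it
     contains. *)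
  split=> [|k u v]; first by apply/mem_set; exists 0; rewrite ?linear0.
  move=> /set_mem [y _ <-] /set_mem [z _ <-].
  by apply/mem_set; exists (k *: y + z); rewrite ?linearP.
have pP : (a, b) \in pullback_pred eta mu by apply/eqP.
have pP' : (a', b') \in pullback_pred eta mu by apply/eqP.
exists (gamma (pullbackq_pi (Pullback pP), pullbackq_pi (Pullback pP'))) => //.
exact: psi_gamma.
Qed.

End Cross.

Theorem proposition5p5 (K : comPzRingType) (g m n : leibnizType K)
    (eta : crossedModule m g) (mu : crossedModule n g) :
  exists psi : {leibniz Gamma (pullbackq eta mu * pullbackq eta mu)%type -> star eta mu},
    [/\ forall p p' : pullback eta mu,
          psi (gamma (pullbackq_pi p, pullbackq_pi p')) =
          star_mn eta mu p.1 p'.2 - star_nm eta mu p.2 p'.1,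
        leib_exact psi (wedge_pi eta mu) &
        range (wedge_pi eta mu) = setT].
Proof.
exists (@psi K g m n eta mu); split=> [p p'||]; first exact: psi_gamma.
- rewrite /leib_exact [LHS]range_psi; apply/seteqP; split=> x /=.
    by move=> bx; rewrite -[RHS](linear0 (wedge_pi eta mu)); apply/leibq_piP; rewrite subr0.
  by rewrite -[X in _ = X -> _](linear0 (wedge_pi eta mu)) => /leibq_piP; rewrite subr0.
- apply/seteqP; split=> // x _.
  by exists (leibq_repr x) => //; exact: leibq_reprK.
Qed.
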